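(* Let $k\geq1$ and let $a=[a_0;a_1,\dots,a_{k-1}]$ be the even- or odd-length continued fraction expansion of a positive rational number. Then $\mathcal{P}(a)\cap\mathbb{Z}^k=\mathcal{B}(a)$, where $\mathcal{P}(a)=\mathrm{conv}(\mathcal{B}(a))\subset\mathbb{R}^k$.
   Context: $a_0\geq0$ and $a_i\geq1$ for $1\leq i<k$. A sequence of integers $(b_i)_{0\leq i<k}$ is admissible for $a$ if: $0\leq b_i\leq a_i$ for all $i$; if $i>0$ is odd and $b_i=a_i$ then $b_{i-1}=a_{i-1}$; if $i>0$ is even and $b_i=0$ then $b_{i-1}=0$. $\mathcal{B}(a)\subset\mathbb{Z}^k$ is the set of admissible sequences for $a$, and $\mathrm{conv}$ denotes convex hull. *)

(* Defs.v *)
From HB Require Import structures.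
From mathcomp Require Import all_boot all_order all_algebra.
From mathcomp Require Import classical_sets reals convex.

Set Implicit Arguments.
Unset Strict Implicit.
Unset Printing Implicit Defensive.

Import Order.TTheory GRing.Theory Num.Theory.

Local Open Scope classical_set_scope.
Local Open Scope ring_scope.

(* The value of [a_0; a_1, ..., a_(k-1)]; the value at [::] is junk. *)
Fixpoint cfrac (s : seq int) : rat :=
  match s with
  | [::] => 0
  | [:: x] => x%:~R
  | x :: s' => x%:~R + (cfrac s')^-1
  end.

(* The last term may be 1, so a positive rational has exactly two expansions,
   one of even length and one of odd length. *)
Definition cfrac_expansion k (a : k.-tuple int) (r : rat) : Prop :=
  [/\ forall i : 'I_k, i = 0%N :> nat -> 0 <= tnth a i,
      forall i : 'I_k, (0 < i)%N -> 1 <= tnth a i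
    & cfrac a = r].

(* In the last two clauses i = j.+1, so j stands for i - 1. *)
Definition admissible k (a : k.-tuple int) (b : 'rV[int]_k) : Prop :=
  [/\ forall i : 'I_k, 0 <= b ord0 i <= tnth a i,
      forall i j : 'I_k, i = j.+1 :> nat -> odd i ->
        b ord0 i = tnth a i -> b ord0 j = tnth a j
    & forall i j : 'I_k, i = j.+1 :> nat -> ~~ odd i ->
        b ord0 i = 0 -> b ord0 j = 0].

Definition admissible_set k (a : k.-tuple int) : set 'rV[int]_k :=
  [set b | admissible a b].

Definition int_embed (R : realType) k (b : 'rV[int]_k) : 'rV[R]_k :=
  map_mx intr b.

Arguments int_embed R {k} b.

Definition int_lattice (R : realType) k : set 'rV[R]_k := range (@int_embed R k).
Arguments int_lattice : clear implicits.

Definition conv_hull (R : realType) k (A : set 'rV[R]_k) : set 'rV[R]_k :=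
  smallest (@convex_set R 'rV[R]_k) A.

Definition polytope (R : realType) k (a : k.-tuple int) : set 'rV[R]_k :=
  conv_hull (@int_embed R k @` admissible_set a).
Arguments polytope R {k} a.

(* Main.v *)
Require Import Defs.
From mathcomp Require Import all_boot all_order all_algebra.
From mathcomp Require Import classical_sets reals.
From mathcomp Require Import interval_inference convex ring lra.

Import Order.TTheory GRing.Theory Num.Theory.

Local Open Scope classical_set_scope.
Local Open Scope ring_scope.

(* Admissible sequences satisfy [0 <= b_i <= a_i], and
   [a_(i-1) - b_(i-1) <= a_(i-1) * (a_i - b_i)] for odd [i],
   [b_(i-1) <= a_(i-1) * b_i] for even [i > 0].  These linear inequalities
   survive on the convex hull; conversely, an integer point satisfying them is
   admissible: if [b_i = a_i] with [i] odd (resp. [b_i = 0] with [i] even), the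
   right-hand side vanishes and forces [b_(i-1)] to its extreme value. *)

Lemma halfspace_convex (R : numDomainType) (k : nat) (c u v : R) (i j : 'I_k) :
  convex_set ([set x | 0 <= c + u * x ord0 i + v * x ord0 j] : set 'rV[R]_k).
Proof.
move=> x y t; rewrite !inE => hx hy; rewrite /= !mxE.
have p0 : 0 <= t%:num by []; have p1 : 0 <= 1 - t%:num by rewrite subr_ge0.
(* Since [c = t * c + (1 - t) * c], the affine form commutes with convex combinations. *)
apply: etrans (addr_ge0 (mulr_ge0 p0 hx) (mulr_ge0 p1 hy)).
by congr (_ <= _); rewrite /unstable.onem; ring.
Qed.

(** The hull lies in every convex set containing the embedded points, in particular in this
    half-space. Integer coefficients let the inequality pass between [int] and [R]. *)
Lemma conv_hull_int_ineq (R : realType) (k : nat) (A : set 'rV[int]_k)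
    (c u v : int) (i j : 'I_k) (b : 'rV[int]_k) :
  (forall x, A x -> 0 <= c + u * x ord0 i + v * x ord0 j) ->
  conv_hull (int_embed R @` A) (int_embed R b) ->
  0 <= c + u * b ord0 i + v * b ord0 j.
Proof.
have intE (x : 'rV[int]_k) : 0 <= c + u * x ord0 i + v * x ord0 j ->
    0 <= c%:~R + u%:~R * int_embed R x ord0 i + v%:~R * int_embed R x ord0 j.
  by rewrite !mxE -!intrM -!intrD ler0z.
move=> hA /(_ [set x | 0 <= c%:~R + u%:~R * x ord0 i + v%:~R * x ord0 j]).
rewrite /= !mxE -!intrM -!intrD ler0z; apply; split.
  exact: halfspace_convex.
by move=> _ [x Ax <-] /=; apply: intE; apply: hA.
Qed.

Lemma cfrac_expansion_ge0 k (a : k.-tuple int) r (i : 'I_k) :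
  cfrac_expansion a r -> 0 <= tnth a i.
Proof.
move=> [a0 aS _]; have [/a0 //|i0] := eqVneq (i : nat) 0%N.
by apply: le_trans (aS i _); rewrite ?lt0n.
Qed.

Theorem theorem11p2 (R : realType) (k : nat) (a : k.-tuple int) (r : rat) :
  (1 <= k)%N -> 0 < r -> cfrac_expansion a r ->
  polytope R a `&` int_lattice R k = int_embed R @` admissible_set a.
Proof.
move=> _ _ aP; have a_ge0 i := cfrac_expansion_ge0 _ _ _ i aP.
apply/seteqP; split=> [y [hb [b _ bE]]|_ [b bP <-]]; last first.
  by split; [apply: sub_gen_smallest; exists b | exists b].
move: hb; rewrite -bE /polytope => hb; exists b => //.
have ineq c u v i j :
    (forall x, admissible a x -> 0 <= c + u * x ord0 i + v * x ord0 j) ->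
    0 <= c + u * b ord0 i + v * b ord0 j.
  by move=> H; apply: conv_hull_int_ineq H hb.
have box i : 0 <= b ord0 i <= tnth a i.
  apply/andP; split.
    (* A bound on one entry is a two-entry form with zero second coefficient. *)
    suff: 0 <= 0 + 1 * b ord0 i + 0 * b ord0 i by lra.
    by apply: ineq => x [/(_ i)/andP[xi _] _ _]; lra.
  suff: 0 <= tnth a i + -1 * b ord0 i + 0 * b ord0 i by lra.
  by apply: ineq => x [/(_ i)/andP[_ xi] _ _]; lra.
split=> // i j ij parity_i bi; apply/eqP; rewrite eq_le;
  have /andP[bj0 bj] := box j; have aj := a_ge0 j.
- rewrite bj /=.
  (* This is [a_j - b_j <= a_j * (a_i - b_i)], expanded into the shape [c + u * b_i + v * b_j]. *)
  suff: 0 <= tnth a j * tnth a i - tnth a j + - tnth a j * b ord0 i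
             + 1 * b ord0 j by rewrite bi; lra.
  apply: ineq => x [x_box x_odd _]; have /andP[_ xi] := x_box i.
  have /andP[xj _] := x_box j.
  have [xiE|xiN] := eqVneq (x ord0 i) (tnth a i).
    by rewrite xiE (x_odd _ _ ij parity_i xiE); lra.
  (* By integrality [a_i - x_i >= 1], so [a_j * (a_i - x_i) >= a_j >= a_j - x_j]. *)
  have : x ord0 i + 1 <= tnth a i by rewrite lezD1 lt_neqAle xiN.
  by rewrite -subr_ge0 => /(mulr_ge0 aj); lra.
- rewrite bj0 andbT.
  suff: 0 <= 0 + tnth a j * b ord0 i + -1 * b ord0 j by rewrite bi; lra.
  apply: ineq => x [x_box _ x_even]; have /andP[xi _] := x_box i.
  have /andP[_ xj] := x_box j.
  have [xiE|xiN] := eqVneq (x ord0 i) 0.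
    by rewrite xiE (x_even _ _ ij parity_i xiE); lra.
  (* Likewise [x_i >= 1] gives [a_j * x_i >= a_j >= x_j]. *)
  have : 0 + 1 <= x ord0 i by rewrite lezD1 lt_neqAle eq_sym xiN.
  by rewrite -subr_ge0 => /(mulr_ge0 aj); lra.
Qed.
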